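(* Let $W=W^{p,q}([m])=V_0\oplus V_1\oplus V_2\oplus V_3$ be the finite-dimensional complex vector space with the operators $E_{11},E_{22},E_{33},L,E_{12},E_{21},E_{23},E_{32}$ given explicitly in the context, for the highest weight $[m]=[m_{13},m_{23},m_{33}]$. Suppose that (class 1) $$[l_{13}+l_{33}+3]=0\quad\text{and}\quad[l_{23}+l_{33}+3]\neq0 .$$ Then the invariant subspace $I_1$ of $W$ for which the factor representation in $W/I_1$ is irreducible is $$I_1=V_3\oplus V_2 .$$
   Context: Parameters. $p,q$ are nonzero complex numbers, generic: none of $p$, $q$, $pq$ is a root of unity. Logarithms $\log p,\log q$ are fixed and $p^x=e^{x\log p}$, $q^x=e^{x\log q}$, $(p/q)^x=p^xq^{-x}$, $(q/p)^x=q^xp^{-x}$ for $x\in\mathbb C$. For $x\in\mathbb C$ put $[x]=\dfrac{q^{x}-p^{-x}}{q-p^{-1}}$. For every integer $n\ge 0$ a square root $[n]^{1/2}$ is fixed, and square roots of products and quotients of such numbers are understood multiplicatively. Weights. $m_{13},m_{23},m_{33}\in\mathbb C$ with $m_{13}-m_{23}\in\mathbb Z_{\ge 0}$. Put $l=\tfrac12(m_{13}-m_{23})$, $l_{13}=m_{13}-1$, $l_{23}=m_{23}-2$, $l_{33}=m_{33}-1$. The numbers $a_1,a_2,a_3$ are arbitrary fixed nonzero complex parameters. The space. For $k=0,1,2,3$ let $(m_{12},m_{22},m_{31})$ be, respectively, $(m_{13},\,m_{23},\,m_{33})$; $(m_{13},\,m_{23}-1,\,m_{33}+1)$; $(m_{13}-1,\,m_{23},\,m_{33}+1)$;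 $(m_{13}-1,\,m_{23}-1,\,m_{33}+2)$. Let $V_k$ be the vector space with basis the symbols $(m)_k$ indexed by all $m_{11}$ with $m_{12}-m_{11}\in\mathbb Z_{\ge0}$ and $m_{11}-m_{22}\in\mathbb Z_{\ge0}$ (so $V_2=0$ if $m_{13}=m_{23}$). Put $W=V_0\oplus V_1\oplus V_2\oplus V_3$, write $(m)=(m)_0$, and $l_{11}=m_{11}-1$, $l_{12}=m_{12}-1$, $l_{22}=m_{22}-2$. The vector $(m)_k^{\pm 11}$ is obtained from $(m)_k$ by replacing $m_{11}$ with $m_{11}\pm1$. A term whose symbol is not one of the basis vectors is read as $0$. Action of the even generators of $U_{p,q}[gl(2/1)]$ (for each $k$, with the $m_{12},m_{22},m_{31}$ of $V_k$): $E_{11}(m)_k=(l_{11}+1)(m)_k$; $E_{22}(m)_k=(l_{12}+l_{22}-l_{11}+2)(m)_k$; $E_{33}(m)_k=m_{31}(m)_k$; $L(m)_k=\tfrac12(l_{12}-l_{22}-1)(m)_k$; $E_{12}(m)_k=([l_{12}-l_{11}][l_{11}-l_{22}])^{1/2}(m)_k^{+11}$; $E_{21}(m)_k=([l_{12}-l_{11}+1][l_{11}-l_{22}-1])^{1/2}(m)_k^{-11}$. Action of the odd generators (all symbols in a given formula have the same $m_{11}$): $E_{23}(m)=0$; $E_{23}(m)_1=a_1(p/q)^{l_{23}+l_{33}+3}\left(\frac{[l_{11}-l_{23}]}{[2l+1]}\right)^{1/2}[l_{23}+l_{33}+3]\,(m)$; $E_{23}(m)_2=a_2(p/q)^{l_{23}+l_{33}+4}\left(\frac{[l_{13}-l_{11}]}{[2l]}\right)^{1/2}[l_{13}+l_{33}+3]\,(m)$;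 $E_{23}(m)_3=a_3(p/q)^{l_{13}+l_{23}+l_{33}-l_{11}+2}\Big\{\frac{1}{a_1q}\left(\frac{[l_{13}-l_{11}]}{[2l+1]}\right)^{1/2}[l_{13}+l_{33}+3]\,(m)_1-\frac{1}{a_2p}([l_{11}-l_{23}][2l])^{1/2}\frac{[l_{23}+l_{33}+3]}{[2l+1]}\,(m)_2\Big\}$; $E_{32}(m)=\frac1{a_1}\left(\frac{[l_{11}-l_{23}]}{[2l+1]}\right)^{1/2}(m)_1+\frac1{a_2}(p/q)^{l_{13}-l_{11}-1}\frac{([l_{13}-l_{11}][2l])^{1/2}}{[2l+1]}\,(m)_2$; $E_{32}(m)_1=\frac{a_1}{a_3}\,p\left(\frac{[l_{13}-l_{11}]}{[2l+1]}\right)^{1/2}(m)_3$; $E_{32}(m)_2=-\frac{a_2}{a_3}\,p\,(q/p)^{l_{13}-l_{11}-1}\left(\frac{[l_{11}-l_{23}]}{[2l]}\right)^{1/2}(m)_3$; $E_{32}(m)_3=0$. A subspace of $W$ is invariant if it is stable under all eight kinds of operators $E_{11},E_{22},E_{33},L,E_{12},E_{21},E_{23},E_{32}$; a representation is irreducible if it is nonzero and has no invariant subspaces other than $0$ and itself. *)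

(* Defs.v *)
From HB Require Import structures.
From mathcomp Require Import all_boot all_order all_algebra.
From mathcomp Require Import generic_quotient ring_quotient.
From mathcomp Require Import complex zify ring.
From mathcomp Require Import boolp reals sequences exp trigo.

Set Implicit Arguments.
Unset Strict Implicit.
Unset Printing Implicit Defensive.

Import Order.TTheory GRing.Theory Num.Theory.
Local Open Scope ring_scope.
Local Open Scope quotient_scope.
Local Open Scope complex_scope.

(* ring_quotient provides the quotient of an additive group by a subgroup;
   the instances below add its vector space structure when the subgroup is a
   linear subspace. *)
Section QuotientSpace.
Import VectorInternalTheory.
Variables (K : fieldType) (V : vectType K) (U : {vspace V}).

Definition quotv : Type := Quotient.quot (pred_of_vspace U).
HB.instance Definition _ := GRing.Zmodule.on quotv.

Definition piv (v : V) : quotv := \pi_(Quotient.quot (pred_of_vspace U)) v.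
Definition reprv (x : quotv) : V := repr (x : Quotient.quot (pred_of_vspace U)).

Lemma reprvK x : piv (reprv x) = x. Proof. exact: reprK. Qed.

Lemma pivD u v : piv (u + v) = piv u + piv v.
Proof. exact: Quotient.pi_add. Qed.

Lemma eq_piv u v : (piv u == piv v) = (u - v \in U).
Proof. by rewrite Quotient.idealrBE. Qed.

Lemma sub_reprv v : reprv (piv v) - v \in U.
Proof. by rewrite -eq_piv reprvK. Qed.

Definition scaleqv a (x : quotv) : quotv := piv (a *: reprv x).

Lemma pivZ a v : piv (a *: v) = scaleqv a (piv v).
Proof.
apply/eqP; rewrite eq_sym eq_piv -scalerBr memvZ //; exact: sub_reprv.
Qed.

Fact scaleqvA a b x : scaleqv a (scaleqv b x) = scaleqv (a * b) x.
Proof. by rewrite -[x]reprvK -!pivZ scalerA. Qed.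

Fact scaleqv1 : left_id 1 scaleqv.
Proof. by move=> x; rewrite -[x]reprvK -pivZ scale1r. Qed.

Fact scaleqvDr : right_distributive scaleqv +%R.
Proof.
by move=> a x y; rewrite -[x]reprvK -[y]reprvK -pivD -!pivZ scalerDr pivD.
Qed.

Fact scaleqvDl x : {morph scaleqv^~ x : a b / a + b}.
Proof. by move=> a b; rewrite -[x]reprvK -!pivZ scalerDl pivD. Qed.

HB.instance Definition _ := GRing.Zmodule_isLmodule.Build K quotv
  scaleqvA scaleqv1 scaleqvDr scaleqvDl.

Fact piv_is_linear : linear piv.
Proof. by move=> a u v; rewrite pivD pivZ. Qed.
HB.instance Definition _ := GRing.isLinear.Build K V quotv _ piv piv_is_linear.

Let proj := daddv_pi U^C U.

Let capUC : (U^C :&: U)%VS = 0%VS.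
Proof. by rewrite capvC capv_compl. Qed.

Let proj_add v : proj v + daddv_pi U U^C v = v.
Proof. by rewrite daddv_pi_add ?capUC // addvC addv_complf memvf. Qed.

Let proj0 u : u \in U -> proj u = 0.
Proof.
move=> uU; apply: (addIr u); rewrite add0r -{3}[u]proj_add.
by rewrite daddv_pi_id ?capv_compl.
Qed.

Let coordqv (x : quotv) : subvs_of U^C := vsproj U^C (proj (reprv x)).

Let coordqvE v : coordqv (piv v) = vsproj U^C (proj v).
Proof.
by congr vsproj; apply/eqP; rewrite -subr_eq0 -linearB /= -/proj proj0 // sub_reprv.
Qed.

Fact quotv_vect_iso : Vector.axiom (dim (subvs_of U^C)) quotv.
Proof.
exists (v2r \o coordqv).
  move=> a x y /=; rewrite -[x]reprvK -[y]reprvK -linearP !coordqvE.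
  by rewrite !linearP.
exists (fun r => piv (vsval (r2v r : subvs_of U^C))).
- move=> x /=; rewrite v2rK -[x in RHS]reprvK /coordqv.
  rewrite vsprojK ?memv_pi //; apply/eqP; rewrite eq_piv.
  by rewrite -[X in _ - X]proj_add opprD addNKr rpredN memv_pi.
- move=> r /=; rewrite coordqvE /proj daddv_pi_id ?subvsP //.
  by rewrite vsvalK r2vK.
Qed.

HB.instance Definition _ := Lmodule_hasFinDim.Build K quotv quotv_vect_iso.

End QuotientSpace.

Section Representations.
Variables (K : fieldType) (V : vectType K) (X : Type) (rho : X -> 'End(V)).

Definition invariant_space (U : {vspace V}) : Prop :=
  forall x, (rho x @: U <= U)%VS.

Definition irreducible_rep : Prop :=
  (fullv : {vspace V}) <> 0%VS /\
  forall U : {vspace V}, invariant_space U -> U = 0%VS \/ U = fullv.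

(* Meaningful only when U is invariant, see factor_repE. *)
Definition factor_rep (U : {vspace V}) (x : X) : 'End(quotv U) :=
  linfun (fun y : quotv U => piv U (rho x (reprv y))).

Lemma factor_repE (U : {vspace V}) x v :
  invariant_space U -> factor_rep U x (piv U v) = piv U (rho x v).
Proof.
move=> invU; pose f (y : quotv U) := piv U (rho x (reprv y)).
have fE w : f (piv U w) = piv U (rho x w).
  apply/eqP; rewrite eq_piv -linearB /=; apply: (subvP (invU x)).
  by rewrite memv_img // sub_reprv.
have f_lin : linear f.
  move=> a y z; rewrite -[y]reprvK -[z]reprvK -linearP !fE.
  by rewrite !linearP.
pose fL := HB.pack_for {linear quotv U -> quotv U} f
  (GRing.isLinear.Build K _ _ _ f f_lin).
by rewrite /factor_rep (lfunE fL) /= fE.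
Qed.

End Representations.

(* The complex exponential, exp(x + iy) = e^x (cos y + i sin y). *)
Definition cexp (R : realType) (z : R[i]) : R[i] :=
  let: x +i* y := z in (expR x * cos y) +i* (expR x * sin y).

(* par_sqrt x stands for [x]^{1/2}: a square root of [n] is fixed for each
   natural number n only (see admissible), and these are the only values that
   enter the action below. *)
Record params (R : realType) := Params {
  par_p : R[i]; par_q : R[i];
  par_logp : R[i]; par_logq : R[i];
  par_sqrt : R[i] -> R[i];
  par_m13 : R[i]; par_m23 : R[i]; par_m33 : R[i];
  par_N : nat;
  par_a1 : R[i]; par_a2 : R[i]; par_a3 : R[i]
}.

Inductive generator := E11 | E22 | E33 | L | E12 | E21 | E23 | E32.

Section Action.
Variables (R : realType) (P : params R).

Local Notation C := (R[i]).
Local Notation p := (par_p P).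
Local Notation q := (par_q P).
Local Notation m13 := (par_m13 P).
Local Notation m23 := (par_m23 P).
Local Notation m33 := (par_m33 P).
Local Notation N := (par_N P).
Local Notation a1 := (par_a1 P).
Local Notation a2 := (par_a2 P).
Local Notation a3 := (par_a3 P).
Local Notation sqrtbr := (par_sqrt P).

Definition ppow (x : C) : C := cexp (x * par_logp P).
Definition qpow (x : C) : C := cexp (x * par_logq P).
Definition pqpow (x : C) : C := ppow x * qpow (- x).
Definition qppow (x : C) : C := qpow x * ppow (- x).

Definition br (x : C) : C := (qpow x - ppow (- x)) / (q - p^-1).

Definition par_l : C := (m13 - m23) / 2%:R.
Definition par_l13 : C := m13 - 1.
Definition par_l23 : C := m23 - 2%:R.
Definition par_l33 : C := m33 - 1.
Local Notation l := par_l.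
Local Notation l13 := par_l13.
Local Notation l23 := par_l23.
Local Notation l33 := par_l33.

Record admissible : Prop := Admissible {
  adm_p0 : p != 0;
  adm_q0 : q != 0;
  adm_logp : cexp (par_logp P) = p;
  adm_logq : cexp (par_logq P) = q;
  adm_p : forall n, (0 < n)%N -> ~~ n.-unity_root p;
  adm_q : forall n, (0 < n)%N -> ~~ n.-unity_root q;
  adm_pq : forall n, (0 < n)%N -> ~~ n.-unity_root (p * q);
  adm_sqrt : forall n : nat, sqrtbr n%:R ^+ 2 = br n%:R;
  adm_N : m13 - m23 = N%:R;
  adm_a1 : a1 != 0;
  adm_a2 : a2 != 0;
  adm_a3 : a3 != 0
}.

Definition m12 (k : nat) : C := nth 0 [:: m13; m13; m13 - 1; m13 - 1] k.
Definition m22 (k : nat) : C := nth 0 [:: m23; m23 - 1; m23; m23 - 1] k.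
Definition m31 (k : nat) : C :=
  nth 0 [:: m33; m33 + 1; m33 + 1; m33 + 2%:R] k.

Definition is_natural (x : C) : Prop := exists n : nat, x = n%:R.

(* The pair (k, j) encodes the symbol (m)_k with m11 = m13 - j. The two
   conditions on m11 force 0 <= m13 - m11 <= N + 1, so that no symbol is missed
   by bounding j (see basisP). *)
Definition pattern (u : 'I_4 * 'I_N.+2) : bool :=
  `[< is_natural (m12 u.1 - (m13 - u.2%:R)) /\
      is_natural ((m13 - u.2%:R) - m22 u.1) >].

Definition basis : finType := {u : 'I_4 * 'I_N.+2 | pattern u}.
Definition lev (b : basis) : nat := (val b).1.
Definition m11 (b : basis) : C := m13 - (val b).2%:R.

Definition W : vectType C := {ffun basis -> C^o}.

(* The basis vector (m)_k with m11 = x if there is one, and 0 otherwise: this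
   implements the convention that a non-existing symbol is read as 0. *)
Definition symb (k : nat) (x : C) : W :=
  [ffun b : basis => ((lev b == k) && (m11 b == x))%:R].

Definition V (k : nat) : {vspace W} :=
  <<[seq symb k (m11 b) | b <- enum basis & lev b == k]>>%VS.

Definition act_even_diag (g : generator) (k : nat) (x : C) : C :=
  let l11 := x - 1 in
  let l12 := m12 k - 1 in
  let l22 := m22 k - 2%:R in
  match g with
  | E11 => l11 + 1
  | E22 => l12 + l22 - l11 + 2%:R
  | E33 => m31 k
  | L => (l12 - l22 - 1) / 2%:R
  | _ => 0
  end.

Definition act_E12 (k : nat) (x : C) : W :=
  let l11 := x - 1 in
  let l12 := m12 k - 1 in
  let l22 := m22 k - 2%:R in
  (sqrtbr (l12 - l11) * sqrtbr (l11 - l22)) *: symb k (x + 1).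

Definition act_E21 (k : nat) (x : C) : W :=
  let l11 := x - 1 in
  let l12 := m12 k - 1 in
  let l22 := m22 k - 2%:R in
  (sqrtbr (l12 - l11 + 1) * sqrtbr (l11 - l22 - 1)) *: symb k (x - 1).

Definition act_E23 (k : nat) (x : C) : W :=
  let l11 := x - 1 in
  match k with
  | 1 => (a1 * pqpow (l23 + l33 + 3%:R)
          * (sqrtbr (l11 - l23) / sqrtbr (2%:R * l + 1))
          * br (l23 + l33 + 3%:R)) *: symb 0 x
  | 2 => (a2 * pqpow (l23 + l33 + 4%:R)
          * (sqrtbr (l13 - l11) / sqrtbr (2%:R * l))
          * br (l13 + l33 + 3%:R)) *: symb 0 x
  | 3 => (a3 * pqpow (l13 + l23 + l33 - l11 + 2%:R)) *:
         ((1 / (a1 * q) * (sqrtbr (l13 - l11) / sqrtbr (2%:R * l + 1))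
           * br (l13 + l33 + 3%:R)) *: symb 1 x
          - (1 / (a2 * p) * (sqrtbr (l11 - l23) * sqrtbr (2%:R * l))
             * (br (l23 + l33 + 3%:R) / br (2%:R * l + 1))) *: symb 2 x)
  | _ => 0
  end.

Definition act_E32 (k : nat) (x : C) : W :=
  let l11 := x - 1 in
  match k with
  | 0 => (1 / a1 * (sqrtbr (l11 - l23) / sqrtbr (2%:R * l + 1))) *: symb 1 x
         + (1 / a2 * pqpow (l13 - l11 - 1)
            * (sqrtbr (l13 - l11) * sqrtbr (2%:R * l) / br (2%:R * l + 1)))
           *: symb 2 x
  | 1 => (a1 / a3 * p * (sqrtbr (l13 - l11) / sqrtbr (2%:R * l + 1)))
         *: symb 3 x
  | 2 => (- (a2 / a3 * p * qppow (l13 - l11 - 1)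
             * (sqrtbr (l11 - l23) / sqrtbr (2%:R * l)))) *: symb 3 x
  | _ => 0
  end.

Definition act_basis (g : generator) (b : basis) : W :=
  let k := lev b in
  let x := m11 b in
  match g with
  | E12 => act_E12 k x
  | E21 => act_E21 k x
  | E23 => act_E23 k x
  | E32 => act_E32 k x
  | _ => act_even_diag g k x *: symb k x
  end.

Definition act_fun (g : generator) (w : W) : W :=
  \sum_(b : basis) w b *: act_basis g b.

Fact act_fun_is_linear g : linear (act_fun g).
Proof.
move=> a u v; rewrite /act_fun scaler_sumr -big_split; apply: eq_bigr => b _.
by rewrite !ffunE scalerDl scalerA.
Qed.
HB.instance Definition _ g :=
  GRing.isLinear.Build C W W _ (act_fun g) (act_fun_is_linear g).

Definition act (g : generator) : 'End(W) := linfun (act_fun g).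

Lemma symb_delta (b b' : basis) : symb (lev b) (m11 b) b' = (b' == b)%:R.
Proof.
rewrite ffunE /lev /m11; congr (nat_of_bool _)%:R.
rewrite (inj_eq (addrI m13)) eqr_opp eqr_nat.
by rewrite -[RHS](inj_eq val_inj) -pair_eqE.
Qed.

Lemma act_symb g b : act g (symb (lev b) (m11 b)) = act_basis g b.
Proof.
rewrite lfunE /= /act_fun (bigD1 b) //= symb_delta eqxx scale1r big1 ?addr0 //.
by move=> b' /negPf neb; rewrite symb_delta neb scale0r.
Qed.

(* The symbols (m)_k are indexed by exactly the prescribed values of m11. *)
Lemma basisP (k : nat) (x : C) : admissible -> (k < 4)%N ->
  (is_natural (m12 k - x) /\ is_natural (x - m22 k)) <->
  (exists b : basis, lev b = k /\ m11 b = x).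
Proof.
move=> admP k4; split; last first.
  by case=> b [<- <-]; have /asboolP := valP b.
case=> -[n En] [m Em].
have Nm : m13 = N%:R + m23 by rewrite -(adm_N admP) subrK.
have Ex : x = m12 k - n%:R by rewrite -En subKr.
have nat_inj (a b : nat) : a%:R = b%:R :> C -> a = b.
  by move/eqP; rewrite eqr_nat => /eqP.
have [j Ej lejN] : exists2 j : nat, x = m13 - j%:R & (j < N.+2)%N.
  move: Em; rewrite Ex; case: k k4 {En Ex} => [|[|[|[|k]]]] // _.
  - rewrite /m12 /m22 /= => Em; exists n => //; suff -> : N = (m + n)%N by lia.
    by apply: nat_inj; rewrite natrD -Em Nm; ring.
  - rewrite /m12 /m22 /= => Em; exists n => //.
    suff : N.+1 = (m + n)%N by lia.
    by apply: nat_inj; rewrite -natr1 natrD -Em Nm; ring.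
  - rewrite /m12 /m22 /= => Em; exists n.+1.
      by rewrite -natr1; ring.
    suff : N = (m + n).+1 by lia.
    by apply: nat_inj; rewrite -natr1 natrD -Em Nm; ring.
  - rewrite /m12 /m22 /= => Em; exists n.+1.
      by rewrite -natr1; ring.
    suff : N = (m + n)%N by lia.
    by apply: nat_inj; rewrite natrD -Em Nm; ring.
have patP : pattern (Ordinal k4, Ordinal lejN).
  by apply/asboolP; rewrite /= -Ej; split; [exists n | exists m].
exists (Sub (Ordinal k4, Ordinal lejN) patP); rewrite /lev /m11 SubK.
by split; [ | rewrite Ej].
Qed.

End Action.

(* Main.v *)
Require Import Defs.
From mathcomp Require Import all_boot all_order all_algebra.
From mathcomp Require Import complex reals.
From mathcomp Require Import zify ring boolp exp trigo.
Import Order.TTheory GRing.Theory Num.Theory.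
Local Open Scope ring_scope.

Set Implicit Arguments.
Unset Strict Implicit.
Unset Printing Implicit Defensive.

(** The operators E11, E33 and L are diagonal on the symbols (m)_k, and their
    joint eigenvalues separate the symbols: E33 and L together determine the
    level k, and E11 determines m11.  Hence an invariant subspace contains
    every symbol on which one of its vectors has a nonzero coordinate
    ([invariant_sym]), and everything reduces to knowing which matrix
    coefficients of E12, E21, E23, E32 between symbols vanish.  A coefficient
    is built by products and quotients from powers of p and q, the parameters
    a_i, brackets [n] with n a natural number and their square roots, and the
    two brackets that class 1 is about; since pq is not a root of unity, [n]
    vanishes only for n = 0.

    Inside a level, E12 and E21 join neighbouring symbols, so that an invariant
    subspace containing one symbol of a level contains the whole level
    ([has_levelP]).  Between levels, E32 leads from 0 to 1, from 1 to 3 and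
    from 2 to 3, while E23 leads from 1 to 0 and from 3 to 2 because
    [l23+l33+3] is nonzero ([level01], [level13], [level23], [level10],
    [level32]).  The remaining arrows of E23, from 2 to 0 and from 3 to 1,
    carry the factor [l13+l33+3] = 0, which makes V3 + V2 invariant
    ([V32_invariant]).  So {0, 1} and {2, 3} are the two strongly connected
    classes of levels, the first one leads to the second, and the only
    invariant subspaces are 0, V3 + V2 and W ([invariant_cases]).

    Irreducibility of W / I means that I is a maximal proper invariant subspace
    ([factor_irreducibleP]).  In the chain 0 < V3 + V2 < W, whose inclusions
    are strict, this singles out V3 + V2. *)

(** * Factor representations and maximal invariant subspaces *)

Section Factor.
Variables (K : fieldType) (V : vectType K) (X : Type) (rho : X -> 'End(V)).
Variable U : {vspace V}.

Lemma piv_eq0 v : (piv U v == 0) = (v \in U).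
Proof. by rewrite -[0](linear0 (piv U)) eq_piv subr0. Qed.

Lemma mem_preim_piv (U' : {vspace quotv U}) v :
  (v \in (linfun (piv U) @^-1: U')%VS) = (piv U v \in U').
Proof. by rewrite -memv_preim lfunE. Qed.

Hypothesis invU : invariant_space rho U.

Lemma preim_piv_invariant (U' : {vspace quotv U}) :
  invariant_space (factor_rep rho U) U' ->
  invariant_space rho (linfun (piv U) @^-1: U')%VS.
Proof.
move=> invU' x; apply/subvP => _ /memv_imgP [v vU' ->].
rewrite mem_preim_piv in vU'; rewrite mem_preim_piv -factor_repE //.
by apply: (subvP (invU' x)); rewrite memv_img.
Qed.

Lemma img_piv_invariant (U' : {vspace V}) :
  invariant_space rho U' ->
  invariant_space (factor_rep rho U) (linfun (piv U) @: U')%VS.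
Proof.
move=> invU' x; apply/subvP => _ /memv_imgP [_ /memv_imgP [v vU' ->] ->].
rewrite lfunE /= factor_repE // -[piv U _](lfunE (piv U)) memv_img //.
by apply: (subvP (invU' x)); rewrite memv_img.
Qed.

Lemma mem_img_piv (U' : {vspace V}) v : (U <= U')%VS ->
  (piv U v \in (linfun (piv U) @: U')%VS) = (v \in U').
Proof.
move=> sUU'; apply/memv_imgP/idP => [[w wU' /eqP]|vU']; last first.
  by exists v; rewrite ?lfunE.
rewrite lfunE eq_piv => /(subvP sUU') vwU'.
by rewrite -(subrK w v) memvD.
Qed.

(** Image and preimage under the projection are inverse to each other between
    the invariant subspaces of the factor and those containing U. *)
Lemma factor_irreducibleP :
  irreducible_rep (factor_rep rho U) <->
  U <> fullv /\ forall U' : {vspace V}, invariant_space rho U' ->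
    (U <= U')%VS -> U' = U \/ U' = fullv.
Proof.
split=> [[nz irr]|[nfull maxU]]; split.
- move=> Ufull; apply: nz; apply/eqP; rewrite -subv0; apply/subvP => y _.
  rewrite -[y]reprvK memv0 piv_eq0; move: (reprv y) => v.
  by rewrite Ufull memvf.
- move=> U' invU' sUU'.
  have [img0|imgf] := irr _ (img_piv_invariant invU'); [left|right].
    apply/eqP; rewrite eqEsubv sUU' andbT; apply/subvP => v vU'.
    by rewrite -piv_eq0 -memv0 -img0 mem_img_piv.
  by apply/vspaceP => v; rewrite memvf -(mem_img_piv _ sUU') imgf memvf.
- move=> full0; apply: nfull; apply/vspaceP => v.
  by rewrite memvf -piv_eq0 -memv0 -full0 memvf.
- move=> U' invU'.
  have sU : (U <= linfun (piv U) @^-1: U')%VS.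
    apply/subvP => v; rewrite -piv_eq0 mem_preim_piv => /eqP ->.
    exact: mem0v.
  have memU' y : (y \in U') = (reprv y \in (linfun (piv U) @^-1: U')%VS).
    by rewrite mem_preim_piv reprvK.
  have [/vspaceP E|/vspaceP E] := maxU _ (preim_piv_invariant invU') sU;
    [left|right]; apply/vspaceP => y; rewrite memU' E.
    by rewrite -piv_eq0 reprvK memv0.
  by rewrite !memvf.
Qed.

End Factor.

(** * The complex exponential *)

Section Cexp.
Variable R : realType.
Implicit Types x y : R[i].

Lemma cexpD x y : cexp (x + y) = cexp x * cexp y.
Proof.
case: x y => [a b] [c d]; rewrite /cexp /= expRD cosD sinD.
by apply/eqP; rewrite eq_complex /=; apply/andP; split; apply/eqP; ring.
Qed.

Lemma cexp0 : cexp (0 : R[i]) = 1.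
Proof. by rewrite /cexp /= expR0 cos0 sin0 mulr1 mulr0. Qed.

Lemma cexp_neq0 x : cexp x != 0.
Proof.
have : cexp x * cexp (- x) != 0 by rewrite -cexpD subrr cexp0 oner_neq0.
by rewrite mulf_eq0 negb_or => /andP [].
Qed.

Lemma cexpMn x n : cexp (n%:R * x) = cexp x ^+ n.
Proof.
elim: n => [|n IHn]; first by rewrite mul0r cexp0 expr0.
by rewrite -natr1 mulrDl mul1r cexpD IHn exprSr.
Qed.

End Cexp.

(** * Brackets of natural numbers *)

Section Proposition.
Variables (R : realType) (P : params R) (admP : admissible P).
Local Notation N := (par_N P).
Local Notation sqrtbr n := (par_sqrt P n%:R).
Local Notation m13 := (par_m13 P).

Lemma pqpow_neq0 x : pqpow P x != 0.
Proof. by rewrite mulf_neq0 ?cexp_neq0. Qed.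

Lemma qppow_neq0 x : qppow P x != 0.
Proof. by rewrite mulf_neq0 ?cexp_neq0. Qed.

(** Since (pq)^n = q^n / p^-n, the numerator of [n] vanishes only when
    (pq)^n = 1; the denominator is the numerator of [1]. *)
Lemma br_nat_neq0 n : (0 < n)%N -> br P n%:R != 0.
Proof.
have pow_neq k : (0 < k)%N -> qpow P k%:R != ppow P (- k%:R).
  move=> /(adm_pq admP) /negP nroot; apply/eqP => E; apply: nroot.
  rewrite unity_rootE exprMn -(adm_logp admP) -(adm_logq admP) -!cexpMn.
  by rewrite -/(qpow P k%:R) E -cexpD -mulrDl subrr mul0r cexp0.
move=> n_gt0; rewrite mulf_neq0 ?subr_eq0 ?pow_neq //.
rewrite invr_eq0 subr_eq0; have := pow_neq 1 isT.
rewrite /qpow /ppow mul1r mulN1r (adm_logq admP); congr (_ != _).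
apply: (mulfI (adm_p0 admP)); rewrite mulfV ?(adm_p0 admP) //.
by rewrite -{1}(adm_logp admP) -cexpD subrr cexp0.
Qed.

Lemma sqrtbr_neq0 n : (0 < n)%N -> sqrtbr n != 0.
Proof.
move=> /br_nat_neq0; rewrite -(adm_sqrt admP); apply: contraNneq => ->.
by rewrite expr0n.
Qed.

(** * Symbols in integral coordinates *)

(** The values of j such that the symbol (m)_k with m11 = m13 - j exists: the
    bound 1 < k accounts for m12 = m13 - 1 in the levels 2 and 3, and odd k for
    m22 = m23 - 1 in the levels 1 and 3. *)
Definition slot k j := [&& (k < 4), (1 < k) <= j & j <= N + odd k]%N.

Definition sym k j : W P := symb P k (m13 - j%:R).

Definition col (b : basis P) : nat := (val b).2.

Lemma symE k j b : sym k j b = ((lev b == k) && (col b == j))%:R.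
Proof. by rewrite ffunE /m11 (inj_eq (addrI _)) eqr_opp eqr_nat. Qed.

Lemma m12E k : (k < 4)%N -> m12 P k = m13 - (1 < k)%N%:R.
Proof. by case: k => [|[|[|[|]]]] // _; rewrite /m12 /= ?subr0. Qed.

Lemma m22E k : (k < 4)%N -> m22 P k = par_m23 P - (odd k)%:R.
Proof. by case: k => [|[|[|[|]]]] // _; rewrite /m22 /= ?subr0. Qed.

Lemma m13E : m13 = par_m23 P + N%:R.
Proof. by rewrite -(adm_N admP) addrC subrK. Qed.

Lemma slotP k j : slot k j <-> exists b : basis P, lev b = k /\ col b = j.
Proof.
have colP b : col b = j <-> m11 b = m13 - j%:R.
  split=> [<- //|/eqP]; rewrite /m11 (inj_eq (addrI _)) eqr_opp eqr_nat.
  by move/eqP.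
split=> [/and3P [k4 lo hi]|[b [Ek Ej]]].
  have /(basisP _ admP k4) [b [Ek Ej]] :
      is_natural (m12 P k - (m13 - j%:R)) /\ is_natural (m13 - j%:R - m22 P k).
    split; [exists (j - (1 < k))%N | exists (N + odd k - j)%N].
      by rewrite m12E // natrB //; ring.
    by rewrite m22E // natrB // natrD m13E; ring.
  by exists b; split=> //; apply/colP.
have k4 : (k < 4)%N by rewrite -Ek; apply: ltn_ord.
have /(basisP _ admP k4) [[n En] [n' En']] :
  exists b0 : basis P, lev b0 = k /\ m11 b0 = m13 - j%:R.
  by exists b; split=> //; apply/colP.
have /eqP E : j%:R = (n + (1 < k))%:R :> R[i].
  by rewrite natrD -En m12E //; ring.
have /eqP E' : (N + odd k)%:R = (n' + j)%:R :> R[i].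
  by rewrite !natrD -En' m22E // m13E; ring.
move: E E'; rewrite !eqr_nat => /eqP E /eqP E'.
by rewrite /slot k4 E' {1}E leq_addl leq_addl.
Qed.

Lemma lev_lt4 (b : basis P) : (lev b < 4)%N.
Proof. exact: ltn_ord. Qed.

Lemma slot_basis b : slot (lev b) (col b).
Proof. by apply/slotP; exists b. Qed.

Lemma symbE (b : basis P) : symb P (lev b) (m11 b) = sym (lev b) (col b).
Proof. by []. Qed.

Lemma sym_eq0 k j : ~~ slot k j -> sym k j = 0.
Proof.
move/negP => nslot; apply/ffunP => b; rewrite symE ffunE.
by case: eqP => //= Ek; case: eqP => //= Ej; case: nslot; apply/slotP; exists b.
Qed.

Lemma sum_sym (w : W P) : w = \sum_b w b *: sym (lev b) (col b).
Proof.
apply/ffunP => b; rewrite sum_ffunE (bigD1 b) //= ffunE symE !eqxx /=.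
rewrite big1 ?addr0 => [|b' nb]; first by rewrite [_ *: _]mulr1.
rewrite ffunE -symbE symb_delta eq_sym (negPf nb); exact: mulr0.
Qed.

(** * Invariant subspaces are spanned by symbols *)

Definition diagonal g := if g is (E11 | E33 | L) then true else false.

Lemma act_diag g (w : W P) b : diagonal g ->
  act P g w b = act_even_diag P g (lev b) (m11 b) * w b.
Proof.
move=> dg; have act_sym b' : act_basis g b' =
    act_even_diag P g (lev b') (m11 b') *: symb P (lev b') (m11 b').
  by case: g dg.
rewrite lfunE /= /act_fun sum_ffunE (bigD1 b) //= big1 => [|b' nb].
  by rewrite ffunE act_sym ffunE symb_delta eqxx addr0 mulrC [_ *: 1]mulr1.
by rewrite ffunE act_sym ffunE symb_delta eq_sym (negPf nb) !scaler0.
Qed.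

(** E33 only confuses the levels 1 and 2, which L tells apart. *)
Lemma diagonal_separates (b b' : basis P) : b' != b -> exists2 g, diagonal g &
  act_even_diag P g (lev b') (m11 b') != act_even_diag P g (lev b) (m11 b).
Proof.
move=> nb; have [Ec|nc] := eqVneq (m11 b') (m11 b); last first.
  by exists E11; rewrite //= !subrK.
have nk : lev b' != lev b.
  apply: contraNneq nb => Ek; have := symb_delta b b'.
  by rewrite ffunE Ek Ec !eqxx /=; case: eqP => // _ /eqP; rewrite oner_eq0.
have m31E k : (k < 4)%N -> m31 P k = par_m33 P + (odd k + (1 < k))%:R.
  by case: k => [|[|[|[|]]]] // _; rewrite /m31 /= ?addr0.
have [|nm] := eqVneq (m31 P (lev b')) (m31 P (lev b)); last by exists E33.
rewrite !m31E ?lev_lt4 // => /addrI /eqP; rewrite eqr_nat => /eqP E3.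
exists L => //=; rewrite !m12E ?m22E ?lev_lt4 //.
have two : (2%:R : R[i]) != 0 by rewrite pnatr_eq0.
apply: contraNneq nk => /(divIf two) E.
have /eqP : (odd (lev b') + (1 < lev b))%:R = (odd (lev b) + (1 < lev b'))%:R
    :> R[i].
  move/eqP: E; rewrite !natrD -subr_eq0 => /eqP E.
  by apply/eqP; rewrite -subr_eq0 -E; apply/eqP; ring.
rewrite eqr_nat; move: E3 (lev_lt4 b) (lev_lt4 b').
by case: (lev b) => [|[|[|[|]]]] //; case: (lev b') => [|[|[|[|]]]].
Qed.

(** The operators act g - c, with c the eigenvalue of g on an unwanted symbol,
    kill that symbol and rescale the others; for g as in [diagonal_separates]
    the coordinate at b survives.  Going through all other symbols leaves a
    nonzero multiple of the symbol of b. *)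
Lemma invariant_sym U w b : invariant_space (act P) U -> w \in U -> w b != 0 ->
  sym (lev b) (col b) \in U.
Proof.
move=> invU wU wb.
have [w' [w'U w'b w's]] : exists w', [/\ w' \in U, w' b != 0 &
    forall b', b' \in enum (basis P) -> b' != b -> w' b' = 0].
  elim: (enum _) => [|b0 s [v [vU vb vs]]]; first by exists w.
  have [->|nb] := eqVneq b0 b.
    exists v; split=> // b'; rewrite inE => /orP [/eqP ->|]; last exact: vs.
    by rewrite eqxx.
  have [g dg sep] := diagonal_separates nb.
  exists (act P g v - act_even_diag P g (lev b0) (m11 b0) *: v).
  have E b' : (act P g v - act_even_diag P g (lev b0) (m11 b0) *: v) b' =
      (act_even_diag P g (lev b') (m11 b') -
       act_even_diag P g (lev b0) (m11 b0)) * v b'.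
    by rewrite !ffunE act_diag // mulrBl.
  split=> [||b']; rewrite ?E.
  - by rewrite memvB ?memvZ // (subvP (invU g)) // memv_img.
  - by rewrite mulf_neq0 // subr_eq0 eq_sym.
  - rewrite inE => /orP [/eqP ->|b's nb']; first by rewrite subrr mul0r.
    by rewrite vs ?mulr0.
rewrite -[sym _ _](scalerK w'b) memvZ //.
suff -> : w' b *: sym (lev b) (col b) = w' by [].
rewrite [RHS]sum_sym (bigD1 b) //= big1 ?addr0 // => b' nb'.
by rewrite w's ?mem_enum ?scale0r.
Qed.

(** * Arrows between symbols *)

(** By [invariant_sym] one nonzero matrix coefficient suffices, whatever other
    terms the image has. *)
Lemma sym_step U g k j k' j' : invariant_space (act P) U ->
  slot k j -> slot k' j' -> sym k j \in U ->
  (forall b b' : basis P, lev b = k -> col b = j ->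
    lev b' = k' -> col b' = j' -> act_basis g b b' != 0) ->
  sym k' j' \in U.
Proof.
move=> invU /slotP [b [Ek Ej]] /slotP [b' [Ek' Ej']] symU nz.
rewrite -Ek' -Ej'; apply: (invariant_sym (w := act P g (sym k j))) => //.
  by rewrite (subvP (invU g)) // memv_img.
by rewrite -Ek -Ej act_symb nz.
Qed.

Lemma twol : 2%:R * par_l P = N%:R.
Proof. by rewrite /par_l (adm_N admP) mulrCA mulfV ?mulr1 // pnatr_eq0. Qed.

Lemma l13_l11 j : par_l13 P - (m13 - j%:R - 1) = j%:R.
Proof. by rewrite /par_l13; ring. Qed.

Lemma l11_l23 j : (j <= N.+1)%N -> m13 - j%:R - 1 - par_l23 P = (N.+1 - j)%:R.
Proof. by move=> jN; rewrite /par_l23 natrB // -natr1 m13E; ring. Qed.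

Lemma raise_sym U k j : invariant_space (act P) U ->
  slot k j -> slot k j.+1 -> sym k j.+1 \in U -> sym k j \in U.
Proof.
move=> invU kj kj1 /(sym_step (g := E12) invU kj1 kj); apply.
move=> b b' Ek Ej Ek' Ej'.
have /and3P [k4 lo _] := kj; have /and3P [_ _ hi] := kj1.
rewrite /act_basis Ek /act_E12 /m11 -/(col b) Ej.
rewrite (_ : m13 - j.+1%:R + 1 = m13 - j%:R); last by rewrite -natr1; ring.
rewrite ffunE -/(sym k j) symE Ek' Ej' !eqxx [_ *: _]mulr1 m12E // m22E //.
rewrite (_ : _ - 1 - (_ - 1) = (j.+1 - (1 < k))%:R); last first.
  by rewrite natrB ?(leqW lo) //; ring.
rewrite (_ : _ - _ - (_ - _ - _) = (N + odd k - j.+1).+1%:R); last first.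
  by rewrite -[in RHS]natr1 natrB // natrD m13E; ring.
by rewrite mulf_neq0 ?sqrtbr_neq0 ?subn_gt0.
Qed.

Lemma lower_sym U k j : invariant_space (act P) U ->
  slot k j -> slot k j.+1 -> sym k j \in U -> sym k j.+1 \in U.
Proof.
move=> invU kj kj1 /(sym_step (g := E21) invU kj kj1); apply.
move=> b b' Ek Ej Ek' Ej'.
have /and3P [k4 lo _] := kj; have /and3P [_ _ hi] := kj1.
rewrite /act_basis Ek /act_E21 /m11 -/(col b) Ej.
rewrite (_ : m13 - j%:R - 1 = m13 - j.+1%:R); last by rewrite -natr1; ring.
rewrite ffunE -/(sym k j.+1) symE Ek' Ej' !eqxx [_ *: _]mulr1 m12E // m22E //.
rewrite (_ : _ - 1 - _ + 1 = (j - (1 < k)).+1%:R); last first.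
  by rewrite -[in RHS]natr1 natrB // -natr1; ring.
rewrite (_ : _ - _ - _ - 1 = (N + odd k - j)%:R); last first.
  by rewrite natrB ?(ltnW hi) // natrD m13E -natr1; ring.
by rewrite mulf_neq0 ?sqrtbr_neq0 ?subn_gt0.
Qed.

(** [sym k j] is 0 when j is not an admissible position, so that no side
    condition on j is called for. *)
Definition has_level (U : {vspace W P}) k := forall j, sym k j \in U.

(** E12 and E21 join neighbouring symbols of a level, in both directions, with
    nonzero coefficients: the level is an irreducible gl(2) module. *)
Lemma has_levelP U k j : invariant_space (act P) U ->
  slot k j -> sym k j \in U -> has_level U k.
Proof.
move=> invU kj symU.
(* Climb to the highest m11, whose position is 0 or 1 according to k, and come
   down from there. *)
have bot : sym k (1 < k)%N \in U.
  have /and3P [_ lo _] := kj; move: kj symU.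
  rewrite -(subnKC lo); elim: (j - _)%N => [|i IHi]; first by rewrite addn0.
  rewrite addnS => kj1.
  have kj : slot k ((1 < k) + i).
    by move: kj1; rewrite /slot => /and3P [-> _ hi]; rewrite leq_addr /= ltnW.
  by move/(raise_sym invU kj kj1); apply: IHi.
move=> i; have [ki|/sym_eq0 ->] := boolP (slot k i); last exact: mem0v.
have /and3P [_ lo _] := ki; move: ki.
rewrite -(subnKC lo); elim: (i - _)%N => [|m IHm]; first by rewrite addn0.
rewrite addnS => km1.
have km : slot k ((1 < k) + m).
  by move: km1; rewrite /slot => /and3P [-> _ hi]; rewrite leq_addr /= ltnW.
exact: (lower_sym invU km km1 (IHm km)).
Qed.

(** * Arrows between levels *)

Section Arrows.
Hypothesis class1_neq0 : br P (par_l23 P + par_l33 P + 3%:R) <> 0.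
Variables (U : {vspace W P}) (invU : invariant_space (act P) U).

(** By [has_levelP], one nonzero coefficient between two levels is enough.  It
    is taken at m11 = m13, the common highest position of the levels 0 and 1,
    and at m11 = m13 - 1 for the arrows that touch the level 2 or 3. *)
Lemma level01 : has_level U 0 -> has_level U 1.
Proof.
move=> /(_ 0); have s0 : slot 0 0 by []. have s1 : slot 1 0 by [].
move=> /(sym_step (g := E32) invU s0 s1) H.
apply: (has_levelP invU s1); apply: H.
move=> b b' Ek Ej Ek' Ej'; rewrite /act_basis Ek /act_E32 /m11 -/(col b) Ej.
rewrite !ffunE /m11 -/(col b') Ek' Ej' !eqxx /= scaler0 addr0 [_ *: _]mulr1.
rewrite l11_l23 // twol natr1 subn0.
by rewrite !mulf_neq0 ?invr_eq0 ?sqrtbr_neq0 ?oner_neq0 ?(adm_a1 admP).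
Qed.

Lemma level10 : has_level U 1 -> has_level U 0.
Proof.
move=> /(_ 0); have s0 : slot 0 0 by []. have s1 : slot 1 0 by [].
move=> /(sym_step (g := E23) invU s1 s0) H.
apply: (has_levelP invU s0); apply: H.
move=> b b' Ek Ej Ek' Ej'; rewrite /act_basis Ek /act_E23 /m11 -/(col b) Ej.
rewrite !ffunE /m11 -/(col b') Ek' Ej' !eqxx /= [_ *: _]mulr1.
rewrite l11_l23 // twol natr1 subn0.
(* Made opaque, or mulf_neq0 would split these factors further. *)
set A := pqpow P _; have A0 : A != 0 by apply: pqpow_neq0.
set B := br P (_ + 3%:R); have B0 : B != 0 by apply/eqP.
clearbody A B.
by rewrite !mulf_neq0 ?invr_eq0 ?sqrtbr_neq0 ?(adm_a1 admP).
Qed.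

Lemma level13 : has_level U 1 -> has_level U 3.
Proof.
have s1 : slot 1 1 by rewrite /slot addn1.
have s3 : slot 3 1 by rewrite /slot addn1.
move=> /(_ 1).
move=> /(sym_step (g := E32) invU s1 s3) H.
apply: (has_levelP invU s3); apply: H.
move=> b b' Ek Ej Ek' Ej'; rewrite /act_basis Ek /act_E32 /m11 -/(col b) Ej.
rewrite !ffunE /m11 -/(col b') Ek' Ej' !eqxx /= [_ *: _]mulr1.
rewrite l13_l11 twol natr1.
by rewrite !mulf_neq0 ?invr_eq0 ?sqrtbr_neq0 ?(adm_a1 admP) ?(adm_a3 admP)
  ?(adm_p0 admP).
Qed.

(** For N = 0 the level 2 is empty and the conclusion is trivial. *)
Lemma level32 : has_level U 3 -> has_level U 2.
Proof.
have [N0 _ j|N_gt0] := posnP N.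
  rewrite sym_eq0 ?mem0v // /slot N0 /= addn0; apply/negP; lia.
have s2 : slot 2 1 by rewrite /slot addn0.
have s3 : slot 3 1 by rewrite /slot addn1.
move=> /(_ 1).
move=> /(sym_step (g := E23) invU s3 s2) H.
apply: (has_levelP invU s2); apply: H.
move=> b b' Ek Ej Ek' Ej'; rewrite /act_basis Ek /act_E23 /m11 -/(col b) Ej.
rewrite !ffunE /m11 -/(col b') Ek' Ej' !eqxx /= scaler0 add0r [_ *: 1]mulr1.
rewrite l11_l23 // twol natr1 subn1.
set A := pqpow P _; have A0 : A != 0 by apply: pqpow_neq0.
set B := br P (_ + 3%:R); have B0 : B != 0 by apply/eqP.
set D := br P _; have D0 : D != 0 by apply: br_nat_neq0.
clearbody A B D.
by rewrite ?mulf_neq0 ?oppr_eq0 ?mulf_neq0 ?invr_eq0 ?mulf_neq0 ?sqrtbr_neq0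
  ?(adm_a2 admP) ?(adm_a3 admP) ?(adm_p0 admP) ?oner_neq0.
Qed.

(** The hypothesis on j says that the level 2 is not empty, that is, N > 0. *)
Lemma level23 j : slot 2 j -> has_level U 2 -> has_level U 3.
Proof.
move=> s2j; have N_gt0 : (0 < N)%N by move: s2j; rewrite /slot /= addn0; lia.
have s2 : slot 2 1 by rewrite /slot addn0.
have s3 : slot 3 1 by rewrite /slot addn1.
move=> /(_ 1).
move=> /(sym_step (g := E32) invU s2 s3) H.
apply: (has_levelP invU s3); apply: H.
move=> b b' Ek Ej Ek' Ej'; rewrite /act_basis Ek /act_E32 /m11 -/(col b) Ej.
rewrite !ffunE /m11 -/(col b') Ek' Ej' !eqxx /= [_ *: 1]mulr1.
rewrite l11_l23 // twol subn1.
set A := qppow P _; have A0 : A != 0 by apply: qppow_neq0.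
clearbody A.
by rewrite oppr_eq0 !mulf_neq0 ?invr_eq0 ?sqrtbr_neq0 ?(adm_a2 admP)
  ?(adm_a3 admP) ?(adm_p0 admP).
Qed.

End Arrows.

(** * Classification of the invariant subspaces *)

Lemma mem_V (w : W P) k b : w \in V P k -> lev b != k -> w b = 0.
Proof.
move=> wV nk.
pose X := [seq symb P k (m11 b0) | b0 <- enum (basis P) & lev b0 == k].
have /coord_span -> : w \in <<in_tuple X>>%VS by [].
rewrite sum_ffunE big1 // => i _; rewrite ffunE.
have /mapP [b' _ ->] : X`_i \in X by rewrite mem_nth.
by rewrite ffunE (negPf nk) /= scaler0.
Qed.

Lemma sym_V (b : basis P) : sym (lev b) (col b) \in V P (lev b).
Proof.
apply: memv_span; apply/mapP; exists b => //.
by rewrite mem_filter eqxx mem_enum.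
Qed.

Lemma mem_V32 (w : W P) :
  w \in (V P 3 + V P 2)%VS <-> forall b : basis P, (lev b < 2)%N -> w b = 0.
Proof.
split=> [/memv_addP [u uV3 [v vV2 ->]] b b2|wlow].
  rewrite ffunE (mem_V uV3) ?(mem_V vV2) ?addr0 //.
    by apply/eqP => E; rewrite E in b2.
  by apply/eqP => E; rewrite E in b2.
rewrite [w]sum_sym; apply: memv_suml => b _.
have [/wlow ->|b2] := ltnP (lev b) 2; first by rewrite scale0r mem0v.
rewrite memvZ //; have := sym_V b; have := lev_lt4 b.
move: b2; case: (lev b) => [|[|[|[|]]]] // _ _.
  by apply: (subvP (addvSr _ _)).
by apply: (subvP (addvSl _ _)).
Qed.

Section Class1.
Hypothesis class1_zero : br P (par_l13 P + par_l33 P + 3%:R) = 0.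

(** The coefficients of E23 from 2 to 0 and from 3 to 1 carry [l13+l33+3]; all
    other terms stay in the levels 2 and 3. *)
Lemma V32_invariant : invariant_space (act P) (V P 3 + V P 2).
Proof.
move=> g; apply/subvP => _ /memv_imgP [w /mem_V32 wlow ->].
apply/mem_V32 => b b2; rewrite lfunE /= /act_fun sum_ffunE big1 // => b' _.
rewrite ffunE; have [/wlow ->|b'2] := ltnP (lev b') 2; first exact: scale0r.
suff -> : act_basis g b' b = 0 by rewrite scaler0.
have symb0 k x : (1 < k)%N -> symb P k x b = 0.
  by move=> k2; rewrite ffunE; case: eqP => // E; rewrite E ltnNge k2 in b2.
have scale_b a (v : W P) : (a *: v) b = a *: v b by rewrite ffunE.
case: g; rewrite /act_basis ?/act_E12 ?/act_E21 ?scale_b ?symb0 ?scaler0 //.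
  have := lev_lt4 b'; move: b'2; case: (lev b') => [|[|[|[|]]]] // _ _ /=.
    by rewrite class1_zero mulr0 scale0r ffunE.
  by rewrite class1_zero mulr0 scale0r sub0r -scaleNr !scale_b symb0 ?scaler0.
have := lev_lt4 b'; move: b'2; case: (lev b') => [|[|[|[|]]]] // _ _ /=.
  by rewrite scale_b symb0 ?scaler0.
by rewrite ffunE.
Qed.

End Class1.

Hypothesis class1_neq0 : br P (par_l23 P + par_l33 P + 3%:R) <> 0.

Lemma has_level3_sub U : invariant_space (act P) U -> has_level U 3 ->
  (V P 3 + V P 2 <= U)%VS.
Proof.
move=> invU U3; have U2 := level32 class1_neq0 invU U3.
apply/subvP => w /mem_V32 wlow; rewrite [w]sum_sym; apply: memv_suml => b _.
have [/wlow ->|b2] := ltnP (lev b) 2; first by rewrite scale0r mem0v.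
rewrite memvZ //; move: b2 (lev_lt4 b).
by case: (lev b) => [|[|[|[|]]]].
Qed.

(** A coordinate of some vector of U in the levels 0 or 1 forces U to contain
    all levels; otherwise U lies in V3 + V2, and equals it as soon as it is
    nonzero. *)
Lemma invariant_cases U : invariant_space (act P) U ->
  [\/ U = 0%VS, U = (V P 3 + V P 2)%VS | U = fullv].
Proof.
move=> invU.
have lvl w b : w \in U -> w b != 0 -> has_level U (lev b).
  move=> wU wb; apply: (has_levelP invU (slot_basis b)).
  exact: invariant_sym wb.
have [[w [b [wU wb b2]]]|nlow] :=
  pselect (exists w b, [/\ w \in U, w b != 0 & (lev b < 2)%N]).
  have U0 : has_level U 0.
    move: (lvl _ _ wU wb) b2; case: (lev b) => [|[|]] //.
    by move/(level10 class1_neq0 invU).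
  have U1 := level01 invU U0; have U3 := level13 invU U1.
  have U2 := level32 class1_neq0 invU U3.
  apply: Or33; apply/eqP; rewrite eqEsubv subvf; apply/subvP => v _.
  rewrite [v]sum_sym; apply: memv_suml => b' _; rewrite memvZ //.
  by move: (lev_lt4 b'); case: (lev b') => [|[|[|[|]]]].
have sU : (U <= V P 3 + V P 2)%VS.
  apply/subvP => w wU; apply/mem_V32 => b b2; apply/eqP/negP => /negP wb.
  by apply: nlow; exists w, b.
have [->|Unz] := eqVneq U 0%VS; first exact: Or31.
apply: Or32; apply/eqP; rewrite eqEsubv sU; apply: has_level3_sub => //.
have wU := memv_pick U; have : vpick U != 0 by rewrite vpick0.
set w := vpick U in wU * => wnz.
have [b wb] : exists b, w b != 0.
  apply: contrapT => wz; case/eqP: wnz; apply/ffunP => b; rewrite ffunE.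
  by apply/eqP/negP => /negP wb; apply: wz; exists b.
have := lvl _ _ wU wb; have := slot_basis b.
have b2 : (1 < lev b)%N.
  by rewrite ltnNge; apply/negP => b2; apply: nlow; exists w, b.
move: b2 (lev_lt4 b); case: (lev b) => [|[|[|[|]]]] // _ _.
exact: level23.
Qed.

Lemma V32_neq0 : (V P 3 + V P 2)%VS <> 0%VS.
Proof.
move=> V0; have s3 : slot 3 1 by rewrite /slot addn1.
have /slotP [b [Ek Ej]] := s3.
have : sym 3 1 \in (V P 3 + V P 2)%VS.
  by apply/mem_V32 => b' b'2; rewrite symE; case: eqP b'2 => // ->.
rewrite V0 memv0 => /eqP /ffunP /(_ b) /eqP.
by rewrite symE Ek Ej !eqxx ffunE oner_eq0.
Qed.

Lemma V32_nfull : (V P 3 + V P 2)%VS <> fullv.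
Proof.
move=> Vf; have s0 : slot 0 0 by [].
have /slotP [b [Ek Ej]] := s0.
have /mem_V32 /(_ b) : sym 0 0 \in (V P 3 + V P 2)%VS by rewrite Vf memvf.
by rewrite Ek symE Ek Ej !eqxx => /(_ isT) /eqP; rewrite oner_eq0.
Qed.

End Proposition.

(** * The maximal invariant subspace *)

Theorem proposition6 (R : realType) (P : params R) (admP : admissible P)
    (class1_zero : br P (par_l13 P + par_l33 P + 3%:R) = 0)
    (class1_neq0 : br P (par_l23 P + par_l33 P + 3%:R) <> 0)
    (I1 : {vspace W P}) :
  (invariant_space (act P) I1 /\ irreducible_rep (factor_rep (act P) I1))
  <-> I1 = (V P 3 + V P 2)%VS.
Proof.
have invV := V32_invariant class1_zero.
have class := invariant_cases admP class1_neq0.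
split=> [[invI /(factor_irreducibleP invI) [nfull maxI]]|->].
  have [I0|//|//] := class _ invI.
  have [||] := maxI _ invV; first by rewrite I0 sub0v.
    by rewrite I0 => /V32_neq0.
  by move/V32_nfull.
split=> //; apply/(factor_irreducibleP invV); split; first exact: V32_nfull.
move=> U invU sVU; have [U0|->|->] := class _ invU; [|by left|by right].
by move: sVU; rewrite U0 subv0 => /eqP /V32_neq0.
Qed.
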